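(* Let $\mathcal{A}$ be an algebra of subsets of a set $X$ and let $\mu$ be a finitely additive probability measure on $(X,\mathcal{A})$. Let $a>0$, let $b>0$, let $I_0\subseteq\mathbb{N}$ with $\bar{d}(I_0)>b$, and let $A_n\in\mathcal{A}$ with $\mu(A_n)\ge a$ for all $n\in I_0$. Then there is a set $I\subseteq I_0$ with $\bar{d}(I)\ge ab$ such that for every finite $J\subseteq I$, $\mu\left(\bigcap_{n\in J}A_n\right)>0$.
   Context: For $I\subseteq\mathbb{N}$, the upper asymptotic density of $I$ is $\bar{d}(I)=\limsup_{n\to\infty}\frac{|I\cap\{1,2,\dots,n\}|}{n}$, where $|\cdot|$ of a finite set denotes its cardinality. A finitely additive probability measure on $(X,\mathcal{A})$ is a function $\mu:\mathcal{A}\to[0,1]$ with $\mu(X)=1$ and $\mu(A\cup B)=\mu(A)+\mu(B)$ for disjoint $A,B\in\mathcal{A}$. The empty intersection (for $J=\emptyset$) is understood to be $X$. *)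

(* Defs.v *)
From mathcomp Require Import all_boot all_order all_algebra finmap.
From mathcomp Require Import all_classical all_reals all_analysis.
Set Implicit Arguments.
Unset Strict Implicit.
Unset Printing Implicit Defensive.
Import Order.TTheory GRing.Theory Num.Theory.
Local Open Scope classical_set_scope.
Local Open Scope ring_scope.

(* [fset_set] is meaningful only on finite sets, which [I `&` [1, n]] is.
   The term at n = 0 is 0 / 0 = 0 and does not affect the limsup; an element
   0 of [I] is never counted. *)
Definition density_upto (R : realType) (I : set nat) (n : nat) : R :=
  #|` fset_set (I `&` [set k | (1 <= k <= n)%N])|%:R / n%:R.

Definition upper_density (R : realType) (I : set nat) : \bar R :=
  limn_esup (fun n => (density_upto R I n)%:E).

(* [{content set X -> \bar R}] is finitely additive and nonnegative; total
   mass 1 then forces its values on the algebra into [0, 1]. *)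
Definition finitely_additive_probability (R : realType) (d : measure_display)
    (X : algebraOfSetsType d) (mu : {content set X -> \bar R}) : Prop :=
  mu setT = 1%E.

(* Main.v *)
Require Import Defs.
From mathcomp Require Import all_boot all_order all_algebra finmap.
From mathcomp Require Import all_classical all_reals all_analysis.
From mathcomp Require Import lra.
Import Order.TTheory GRing.Theory Num.Theory.
Local Open Scope classical_set_scope.
Local Open Scope ring_scope.

(** The idea is to find a single ultrafilter [U] on [X] playing the part of a
  random point, and to take for [I] the set of those [k] in [I0] with
  [A k] in [U], the indices of the sets which that point belongs to. If every
  measurable member of [U] has positive measure, then so has every finite
  intersection of sets [A k], [k] in [I], since it is again a member of [U].

  To give [I] a large density, fix [c] with [b < c < upper_density I0] and let
  [E n] be the set of points [x] for which more than [a b n] of the indices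
  [k <= n] in [I0] satisfy [A k x]. For the infinitely many [n] at which [I0]
  has density above [c], the counting function has mean at least [a c] times
  [n], so [E n] has measure at least [a (c - b)]
  ([sum_prob_le_count]). If [E n] is a member of [U], then the density of [I]
  up to [n] exceeds [a b]: by [ultra_count], [U]-almost every point is in the
  same sets [A k], [k <= n], as the ultrafilter itself.

  So [U] has to contain [E n] for infinitely many [n]. For a countably
  additive measure a point in infinitely many [E n] would come from Fatou's
  lemma; here [frequent_ultrafilter] replaces it. Each tail
  [E m, E (m + 1), ...] is exhausted, up to a small error of order [2 ^- m],
  by a finite union [V m] of its terms. As any finitely many of these errors
  sum to less than [a (c - b)], the finite intersections of the sets [V m]
  have positive measure, so an ultrafilter of the required kind contains all
  of them ([positive_ultrafilter]); an ultrafilter containing a finite union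
  contains one of its terms. *)

(** * Upper limits and counting *)

Lemma lt_limn_esup_frequently (R : realType) (u : nat -> \bar R) (c : \bar R) :
  (c < limn_esup u)%E ->
  forall m : nat, exists2 n, (m <= n)%N & (c < u n)%E.
Proof.
move=> cu m.
have : (c < ereal_sup [set u n | n in [set n | (m <= n)%N]])%E.
  apply: (lt_le_trans cu); rewrite /limn_esup limf_esupE.
  by apply: ereal_inf_lbound; exists [set n | (m <= n)%N] => //; exists m.
by move=> /ereal_sup_gt[_ [n /= mn <-] cun]; exists n.
Qed.

Lemma frequently_le_limn_esup (R : realType) (u : nat -> \bar R) (c : \bar R) :
  (forall m : nat, exists2 n, (m <= n)%N & (c <= u n)%E) ->
  (c <= limn_esup u)%E.
Proof.
move=> cu; rewrite /limn_esup limf_esupE.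
apply: le_ereal_inf_tmp => _ [V [m _ mV] <-].
have [n mn cun] := cu m.
by apply: (le_trans cun); apply: ereal_sup_ubound; exists n => //; apply: mV.
Qed.

Lemma card_fset_set_count (I : set nat) (n : nat) :
  #|` fset_set (I `&` [set k | (1 <= k <= n)%N])| =
  count (fun k => `[< I k >]) (iota 1 n).
Proof.
have fin : finite_set (I `&` [set k | (1 <= k <= n)%N]).
  apply: finite_setIr; apply: (sub_finite_set _ (finite_II n.+1)) => k /=.
  by case/andP.
rewrite -size_filter; apply: perm_size; apply: uniq_perm.
- exact: fset_uniq.
- by rewrite filter_uniq // iota_uniq.
- move=> k; rewrite mem_filter mem_iota add1n ltnS in_fset_set //.
  apply/idP/andP => [/set_mem[Ik kn]|[/asboolP Ik kn]].
    by split=> //; apply/asboolP.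
  by apply/mem_set.
Qed.

(** * Ultrafilters *)

Lemma proper_filterC (X : Type) (F : set_system X) (B : set X) :
  ProperFilter F -> F B -> F (~` B) -> False.
Proof.
move=> FF FB FCB; apply: (@filter_not_empty _ F FF).
by rewrite -(setICr B); exact: filterI.
Qed.

(** An ultrafilter decides each [A k], and finitely many decisions hold
  simultaneously on one of its members. *)
Lemma ultra_count (X : Type) (U : set_system X) (T : Type) (A : T -> set X)
    (s : seq T) : UltraFilter U ->
  U [set x | count (fun k => `[< A k x >]) s = count (fun k => `[< U (A k) >]) s].
Proof.
move=> UU; elim: s => [|k s IH] /=; first exact: filterE.
have [UAk|UAk] := in_ultra_setVsetC (A k) UU.
  apply: filterS (filterI UAk IH) => x [/= Akx ->].
  by rewrite !asboolT.
apply: filterS (filterI UAk IH) => x [/= Akx ->].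
rewrite !asboolF// => UAk'.
exact: (proper_filterC _ _ _ _ UAk' UAk).
Qed.

(** * Finitely additive probabilities *)

Section Content.
Variables (R : realType) (d : measure_display) (X : algebraOfSetsType d).
Variable mu : {content set X -> \bar R}.

(** The measurable sets containing some [P n] up to a null set form a filter
  base, and positivity of [P n] keeps the empty set out of it. An ultrafilter
  refining it contains the complement of each null set, hence no null set. *)
Lemma positive_ultrafilter (P : nat -> set X) :
  (forall n, d.-measurable (P n)) ->
  (forall n, (0 < mu (P n))%E) ->
  (forall m n, (m <= n)%N -> P n `<=` P m) ->
  exists U : set_system X,
    [/\ UltraFilter U, forall n, U (P n) &
        forall B, d.-measurable B -> U B -> (0 < mu B)%E].
Proof.
move=> mP P_gt0 P_noninc.
pose D := [set C | d.-measurable C /\ exists n, mu (P n `\` C) = 0%E].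
have DP n : D (P n) by split=> //; exists n; rewrite setDv measure0.
have filF : Filter (filter_from D id).
  apply: filter_from_filter; first by exists (P 0%N).
  move=> B C [mB [i PB]] [mC [j PC]]; exists (B `&` C) => //.
  split; first exact: measurableI.
  exists (maxn i j); apply/eqP; rewrite eq_le measure_ge0 andbT.
  have PBC : P (maxn i j) `\` (B `&` C) `<=` (P i `\` B) `|` (P j `\` C).
    move=> x [Px nBC]; have [Bx|nBx] := pselect (B x).
      right; split; first exact: P_noninc (leq_maxr _ _) _ Px.
      by move=> Cx; apply: nBC.
    by left; split => //; exact: P_noninc (leq_maxl _ _) _ Px.
  have mPB : d.-measurable (P i `\` B) by exact: measurableD.
  have mPC : d.-measurable (P j `\` C) by exact: measurableD.
  apply: (@le_trans _ _ (mu ((P i `\` B) `|` (P j `\` C)))).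
    apply: le_measure => //; rewrite inE; last exact: measurableU.
    by apply: measurableD => //; exact: measurableI.
  apply: (le_trans (measureU2 _ _ _)) => //.
  by move: PB PC => /= -> ->; rewrite adde0.
have propF : ProperFilter (filter_from D id).
  apply: filter_from_proper => // C [mC [n PC]].
  apply/set0P/eqP => C0; move: PC; rewrite C0 setD0 => PC.
  by have := P_gt0 n; rewrite PC ltxx.
have [U [UU FU]] := ultraFilterLemma propF.
exists U; split => // [n|B mB UB]; first by apply: FU; exists (P n).
rewrite lt_neqAle measure_ge0 andbT; apply/eqP => B0.
have UCB : U (~` B).
  apply: FU; exists (~` B) => //; split; first exact: measurableC.
  exists 0%N; apply/eqP; rewrite eq_le measure_ge0 andbT [leRHS]B0.
  rewrite setDE setCK; apply: le_measure; rewrite ?inE //.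
  exact: measurableI.
exact: (proper_filterC _ _ _ _ UB UCB).
Qed.

Hypothesis mu_prob : finitely_additive_probability mu.

Let pr (B : set X) : R := fine (mu B).

Let le_pr (B C : set X) : d.-measurable B -> d.-measurable C -> B `<=` C ->
  (mu B <= mu C)%E.
Proof. by move=> mB mC; apply: le_measure; rewrite inE. Qed.

Lemma fin_num_prob (B : set X) : d.-measurable B -> mu B \is a fin_num.
Proof.
move=> mB; rewrite ge0_fin_numE ?measure_ge0//.
apply: (@le_lt_trans _ _ (mu setT)); last by rewrite mu_prob ltry.
exact: le_pr.
Qed.

Let prE (B : set X) : d.-measurable B -> mu B = (pr B)%:E.
Proof. by move=> mB; rewrite fineK // fin_num_prob. Qed.

Let pr_ge0 (B : set X) : 0 <= pr B.
Proof. by rewrite fine_ge0. Qed.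

Let pr_mono (B C : set X) : d.-measurable B -> d.-measurable C -> B `<=` C ->
  pr B <= pr C.
Proof. by move=> mB mC BC; rewrite -lee_fin -!prE//; exact: le_pr. Qed.

Let prT : pr setT = 1.
Proof. by rewrite /pr mu_prob. Qed.

Let pr_split (B C : set X) : d.-measurable B -> d.-measurable C ->
  pr B = pr (B `&` C) + pr (B `\` C).
Proof.
move=> mB mC; apply: EFin_inj; rewrite EFinD -!prE//.
- by rewrite (measureDI mu mB mC) addeC.
- exact: measurableD.
- exact: measurableI.
Qed.

(** Whether [x] is in [A k] shifts the threshold by one for the remaining
  sets; this recursion passes through negative thresholds, so [t] is an
  arbitrary real. *)
Lemma measurable_count_gt (T : eqType) (A : T -> set X) (s : seq T) (t : R) :
  (forall k, k \in s -> d.-measurable (A k)) ->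
  d.-measurable [set x | t < (count (fun k => `[< A k x >]) s)%:R].
Proof.
elim: s t => [|k s IH] t mA /=.
  by have [t0|t0] := ltP t 0; [rewrite (_ : [set _ | _] = setT)|
    rewrite (_ : [set _ | _] = set0)] => //; apply/seteqP; split=> x //=.
have mAk : d.-measurable (A k) by apply: mA; rewrite mem_head.
have {}IH t' := IH t' (fun j js => mA j (mem_behead (s := k :: s) js)).
rewrite (_ : [set _ | _] =
  (A k `&` [set x | t - 1 < (count (fun k => `[< A k x >]) s)%:R]) `|`
  ([set x | t < (count (fun k => `[< A k x >]) s)%:R] `\` A k)).
  apply: measurableU; first exact: measurableI.
  exact: measurableD.
apply/seteqP; split=> x /=.
- have [Akx|Akx] := pselect (A k x).
    by rewrite asboolT // natrD -ltrBlDl; left.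
  by rewrite asboolF // add0n; right.
- case=> -[]; first by move=> Akx; rewrite asboolT // natrD -ltrBlDl.
  by move=> + Akx; rewrite asboolF.
Qed.

(** The left side is the integral over [B] of the number of sets [A k] that
  contain the point. This number is at most [t] where it does not exceed [t],
  and at most [size s] elsewhere. The induction on [s] avoids integrals; it
  splits [B] along the first set, and so needs the inequality for all [B]. *)
Lemma sum_prob_le_count (T : eqType) (A : T -> set X) (s : seq T) (t : R)
    (B : set X) :
  (forall k, k \in s -> d.-measurable (A k)) -> d.-measurable B -> 0 <= t ->
  \sum_(k <- s) fine (mu (A k `&` B)) <=
    t * fine (mu B) + (size s)%:R *
      fine (mu (B `&` [set x | t < (count (fun k => `[< A k x >]) s)%:R])).
Proof.
elim: s t B => [|k s IH] t B mA mB t0.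
  by rewrite big_nil mul0r addr0 mulr_ge0 // pr_ge0.
(* Lowering the threshold by one inside [A k] is possible only for [1 <= t].
   Below that, every [A j] lies in the set where the count exceeds [t]. *)
have [t1|t1] := ltP t 1.
  rewrite -[leLHS]add0r lerD ?mulr_ge0 ?pr_ge0 //.
  have -> : (size (k :: s))%:R = \sum_(j <- k :: s) 1 :> R.
    by rewrite big_const_seq count_predT iter_addr_0.
  rewrite mulr_suml big_seq [leRHS]big_seq; apply: ler_sum => j js.
  rewrite mul1r; apply: pr_mono.
  - by apply: measurableI => //; exact: mA.
  - by apply: measurableI => //; exact: measurable_count_gt.
  - move=> x [Ajx Bx]; split => //; apply: (lt_le_trans t1).
    by rewrite ler1n -[(0 < _)%N]has_count; apply/hasP; exists j => //; apply/asboolP.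
have mAk : d.-measurable (A k) by apply: mA; rewrite mem_head.
have mAs j : j \in s -> d.-measurable (A j).
  by move=> js; apply: mA; rewrite inE js orbT.
have mBA : d.-measurable (B `&` A k) by exact: measurableI.
have mBD : d.-measurable (B `\` A k) by exact: measurableD.
have t10 : 0 <= t - 1 by rewrite subr_ge0.
have := IH (t - 1) (B `&` A k) mAs mBA t10.
have := IH t (B `\` A k) mAs mBD t0.
rewrite -!/(pr _).
set E := [set x | t < (count (fun k => `[< A k x >]) (k :: s))%:R].
have mE : d.-measurable E by exact: measurable_count_gt.
have -> : (B `\` A k) `&` [set x | t < (count (fun k => `[< A k x >]) s)%:R] =
    (B `&` E) `\` A k.
  by apply/seteqP; split=> x /= [[Bx +] +]; rewrite /E /= => h1 h2;
    (do 2?split) => //; move: h1 h2 => /=;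
    [move=> h1 h2; rewrite asboolF | move=> + h2; rewrite asboolF].
have -> : (B `&` A k) `&` [set x | t - 1 < (count (fun k => `[< A k x >]) s)%:R] =
    (B `&` E) `&` A k.
  by apply/seteqP; split=> x /= [[Bx +] +]; rewrite /E /= => h1 h2;
    (do 2?split) => //; move: h1 h2 => /=;
    [move=> h1; rewrite asboolT // natrD -ltrBlDl
    |move=> + h2; rewrite asboolT // natrD -ltrBlDl].
have -> : \sum_(j <- s) fine (mu (A j `&` (B `\` A k))) =
    \sum_(j <- s) pr ((A j `&` B) `\` A k).
  by apply: eq_bigr => j _; rewrite setIDA.
have -> : \sum_(j <- s) fine (mu (A j `&` (B `&` A k))) =
    \sum_(j <- s) pr ((A j `&` B) `&` A k).
  by apply: eq_bigr => j _; rewrite setIA.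
have EB : pr (B `&` E) = pr (B `&` E `&` A k) + pr ((B `&` E) `\` A k).
  by apply: pr_split => //; exact: measurableI.
have BB := pr_split _ _ mB mAk.
have -> : \sum_(j <- k :: s) pr (A j `&` B) = pr (B `&` A k) +
    (\sum_(j <- s) pr ((A j `&` B) `&` A k) +
     \sum_(j <- s) pr ((A j `&` B) `\` A k)).
  rewrite big_cons setIC -big_split /=; congr (_ + _).
  rewrite big_seq [RHS]big_seq; apply: eq_bigr => j js.
  by apply: pr_split => //; apply: measurableI => //; exact: mAs.
have : (size s)%:R * pr (B `&` E) <= (size (k :: s))%:R * pr (B `&` E).
  by rewrite ler_wpM2r ?pr_ge0 // ler_nat.
rewrite {1}EB BB mulrDr; lra.
Qed.

(** A finitely additive substitute for the fact that the upper limit of sets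
  of measure at least [delta] has measure at least [delta]. *)
Lemma frequent_ultrafilter (E : nat -> set X) (delta : R) : 0 < delta ->
  (forall n, d.-measurable (E n)) ->
  (forall m, exists2 n, (m <= n)%N & (delta%:E <= mu (E n))%E) ->
  exists U : set_system X,
    [/\ UltraFilter U,
        forall B, d.-measurable B -> U B -> (0 < mu B)%E &
        forall m, exists2 n, (m <= n)%N & U (E n)].
Proof.
move=> delta_gt0 mE E_ge.
pose W m N := \bigcup_(j in [set j | (m <= j < N)%N]) E j.
have mW m N : d.-measurable (W m N).
  apply: fin_bigcup_measurable => //.
  by apply: sub_finite_set (finite_II N) => j /= /andP[].
(* The errors are chosen to have sum [delta]; all finite sums are smaller. *)
pose e m : R := delta / 2 ^+ m.+1.
have e_gt0 m : 0 < e m by rewrite divr_gt0 // exprn_gt0.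
have N_ex m : exists N, forall n, (m <= n)%N ->
    pr (E n `\` W m N) <= e m.
  (* [W m N] nearly reaches the supremum of the measures of the finite unions
     of the tail, so no later set can add more than [e m] to it. *)
  have supW : has_sup (range (fun N => pr (W m N))).
    split; first by exists (pr (W m 0%N)), 0%N.
    by exists 1 => _ [n _ <-]; rewrite -prT; apply: pr_mono.
  have [_ [N _ <-] supN] := sup_adherent (e_gt0 m) supW.
  exists N => n mn; set M := maxn N n.+1.
  have WM : pr (W m M) <= sup (range (fun N => pr (W m N))).
    by apply: ub_le_sup; [case: supW|exists M].
  have WW : W m N `<=` W m M.
    move=> x [j /= /andP[mj jN] Ejx]; exists j => //=.
    by rewrite mj (leq_trans jN) // leq_maxl.
  have EW : E n `\` W m N `<=` W m M `\` W m N.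
    move=> x [Enx nW]; split => //; exists n => //=.
    by rewrite mn leq_maxr.
  have := pr_split (W m M) (W m N) (mW _ _) (mW _ _).
  rewrite (setIidr WW) => WMN.
  have : pr (E n `\` W m N) <= pr (W m M `\` W m N).
    by apply: pr_mono => //; apply: measurableD.
  lra.
have [N EN] := boolp.choice N_ex.
pose V m := W m (N m).
pose P K := \bigcap_(m in `I_K) V m.
have mP K : d.-measurable (P K).
  by apply: fin_bigcap_measurable => // m _; exact: mW.
have PS K : P K.+1 = P K `&` V K.
  apply/seteqP; split => [x PK|x [PK VK] m /=].
    by split=> [m /= mK|]; apply: PK => //=; rewrite ltnS // ltnW.
  by rewrite ltnS leq_eqVlt => /predU1P[->//|mK]; exact: PK.
(* The first [K] sets [V m] remove at most [e 0 + ... + e (K - 1)] from any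
   later [E n]. *)
have EP K n : (K <= n)%N -> pr (E n) - delta * (1 - (2 ^+ K)^-1) <= pr (E n `&` P K).
  elim: K => [_|K IH Kn].
    rewrite expr0 invr1 subrr mulr0 subr0 /P.
    by rewrite (_ : `I_0 = set0) ?II0 // bigcap_set0 setIT.
  have := IH (ltnW Kn); have := EN K n (ltnW Kn).
  rewrite PS setIA.
  have -> := pr_split (E n `&` P K) (V K) (measurableI _ _ (mE n) (mP K)) (mW _ _).
  have : pr ((E n `&` P K) `\` V K) <= pr (E n `\` V K).
    apply: pr_mono.
    - by apply: measurableD; [exact: measurableI|exact: mW].
    - by apply: measurableD => //; exact: mW.
    - by move=> x [[]].
  rewrite /e -/(V K) exprS invfM.
  move: (2 ^+ K)^-1 => z; lra.
have [||m n mn|U [UU UP Upos]] := @positive_ultrafilter P.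
- exact: mP.
- move=> K; have [n Kn En] := E_ge K.
  rewrite prE // lte_fin.
  have : pr (E n `&` P K) <= pr (P K).
    by apply: pr_mono => //; exact: measurableI.
  have := EP K n Kn; rewrite prE // lee_fin in En.
  have : 0 < delta * (2 ^+ K)^-1 by rewrite mulr_gt0 // invr_gt0 exprn_gt0.
  lra.
- by move=> x PnX j /= jm; apply: PnX; exact: leq_trans jm mn.
exists U; split => // m.
have UV : U (V m) by apply: filterS (UP m.+1) => x; apply => /=.
(* Otherwise [U] contains the complements of the finitely many sets [E j]
   whose union is [V m]. *)
apply: contrapT => nE.
have : U (\bigcap_(j in [set j | (m <= j < N m)%N]) ~` E j).
  rewrite -(@fset_setK _ [set j | (m <= j < N m)%N]); last first.
    by apply: sub_finite_set (finite_II (N m)) => j /= /andP[].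
  apply: filter_bigI => j; rewrite in_fset_set; last first.
    by apply: sub_finite_set (finite_II (N m)) => i /= /andP[].
  move=> /set_mem /= /andP[mj _].
  have [UE|//] := in_ultra_setVsetC (E j) UU.
  by case: nE; exists j.
rewrite -setC_bigcup => UCV.
exact: (proper_filterC _ _ _ _ UV UCV).
Qed.

End Content.

Theorem corollary4 (R : realType) (d : measure_display)
    (X : algebraOfSetsType d) (mu : {content set X -> \bar R})
    (mu_prob : finitely_additive_probability mu)
    (a b : R) (a_gt0 : 0 < a) (b_gt0 : 0 < b)
    (I0 : set nat) (I0_dens : (b%:E < upper_density R I0)%E)
    (A : nat -> set X)
    (A_meas : forall n, I0 n -> d.-measurable (A n))
    (A_ge : forall n, I0 n -> (a%:E <= mu (A n))%E) :
  exists I : set nat,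
    [/\ I `<=` I0,
        ((a * b)%:E <= upper_density R I)%E &
        forall J : set nat, finite_set J -> J `<=` I ->
          (0 < mu (\bigcap_(n in J) A n))%E].
Proof.
have [c bc cI0] : exists2 c : R, b < c & (c%:E < upper_density R I0)%E.
  move: I0_dens; case: (upper_density R I0) => [r||] //.
    rewrite lte_fin => br; exists ((b + r) / 2); rewrite ?lte_fin; lra.
  by move=> _; exists (b + 1); rewrite ?ltry //; lra.
pose s n := [seq k <- iota 1 n | `[< I0 k >]].
have sI0 n k : k \in s n -> I0 k by rewrite mem_filter => /andP[/asboolP].
have s_meas n k : k \in s n -> d.-measurable (A k) by move=> /sI0 /A_meas.
have size_s n : (size (s n) <= n)%N.
  by rewrite -[leqRHS](size_iota 1 n) size_filter count_size.
pose E n := [set x | a * b * n%:R < (count (fun k => `[< A k x >]) (s n))%:R].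
have mE n : d.-measurable (E n) by exact: measurable_count_gt (s_meas n).
have E_ge m : exists2 n, (m <= n)%N & ((a * (c - b))%:E <= mu (E n))%E.
  have [n mn] := lt_limn_esup_frequently _ _ _ cI0 m.
  rewrite lte_fin /density_upto card_fset_set_count -size_filter -/(s n).
  (* At [n = 0] the density is a quotient by zero, hence [0], below [c]. *)
  have [->|n_gt0] := posnP n; first by rewrite invr0 mulr0; lra.
  have n0 : 0 < n%:R :> R by rewrite ltr0n.
  rewrite ltr_pdivlMr // => cn; exists n => //.
  rewrite -(fineK (fin_num_prob _ _ _ _ mu_prob _ (mE n))) lee_fin.
  have ab0 : 0 <= a * b * n%:R by rewrite !mulr_ge0 // ltW.
  have := sum_prob_le_count _ _ _ _ mu_prob _ A (s n) _ setT (s_meas n) measurableT ab0.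
  rewrite setTI -/(E n) mu_prob mulr1 => sumE.
  have sum_ge : a * (size (s n))%:R <= \sum_(k <- s n) fine (mu (A k `&` setT)).
    have -> : a * (size (s n))%:R = \sum_(k <- s n) a.
      by rewrite big_const_seq count_predT iter_addr_0 mulr_natr.
    rewrite big_seq [leRHS]big_seq; apply: ler_sum => k ks.
    rewrite setIT -lee_fin fineK; first exact/A_ge/(sI0 n).
    by apply: (fin_num_prob _ _ _ _ mu_prob); exact: s_meas ks.
  have sE : (size (s n))%:R * fine (mu (E n)) <= n%:R * fine (mu (E n)).
    by rewrite ler_wpM2r ?fine_ge0 // ler_nat.
  have acn : a * (c * n%:R) <= a * (size (s n))%:R by rewrite ler_wpM2l // ltW.
  suff : n%:R * (a * (c - b)) <= n%:R * fine (mu (E n)) by rewrite ler_pM2l.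
  lra.
have delta_gt0 : 0 < a * (c - b) by rewrite mulr_gt0 // subr_gt0.
have [U [UU Upos UE]] :=
  frequent_ultrafilter _ _ _ _ mu_prob E _ delta_gt0 mE E_ge.
exists [set k | I0 k /\ U (A k)]; split.
- by move=> k [].
- apply: frequently_le_limn_esup => m.
  (* Starting from [m + 1] makes [n] positive, so that the density is a
     genuine quotient. *)
  have [n mn UEn] := UE m.+1; exists n; first exact: ltnW.
  rewrite lee_fin /density_upto card_fset_set_count.
  rewrite ler_pdivlMr ?ltr0n ?(leq_trans _ mn) //.
  have [x [Enx /= cx]] := filter_ex (filterI UEn (ultra_count _ _ _ A (s n) UU)).
  move: Enx; rewrite /E /= cx count_filter => /ltW; congr (_ <= _%:R).
  by apply: eq_count => k /=; rewrite andbC -asbool_and.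
- move=> J finJ JI; apply: Upos.
    by apply: fin_bigcap_measurable => // k /JI[/A_meas].
  rewrite -(fset_setK finJ); apply: filter_bigI => k.
  by rewrite in_fset_set // => /set_mem /JI[].
Qed.
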